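(* Let $G$ be a connected bipartite transmission regular graph with $n\ge 2$ vertices, let $u\in V(G)$, and let $r\ge 2$ be an integer. Then the graph $rG(u)$ is a $((r-1)(n-1))$-STI graph.
   Context: All graphs are finite, simple and connected. The transmission of a vertex $u$ is $\mathrm{Tr}_G(u)=\sum_{x\in V(G)} d_G(u,x)$, where $d_G$ is the shortest-path distance. $G$ is transmission regular if all its vertices have the same transmission. For an integer $k\ge 1$, $G$ is a $k$-STI graph if $|\mathrm{Tr}_G(x)-\mathrm{Tr}_G(y)|=k$ for every edge $xy\in E(G)$. For a vertex $u$ of $G$, $rG(u)$ denotes the graph obtained from $r$ disjoint copies of $G$ by identifying the $r$ copies of $u$ into a single vertex. *)

(* Defs.v *)
From HB Require Import structures.
From mathcomp Require Import all_boot all_algebra.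

Set Implicit Arguments.
Unset Strict Implicit.
Unset Printing Implicit Defensive.

Record sgraph := SGraph {
  vertex :> finType;
  adj : rel vertex;
  adj_sym : symmetric adj;
  adj_irrefl : irreflexive adj }.

Definition connected (G : sgraph) : Prop :=
  forall x y : G, connect (@adj G) x y.

Definition bipartite (G : sgraph) : Prop :=
  exists c : G -> bool, forall x y : G, adj x y -> c x != c y.

Definition walk_of_length (G : sgraph) (x y : G) (k : nat) : bool :=
  [exists p : k.-tuple G, path (@adj G) x p && (last x p == y)].

(* The least length of a walk from [x] to [y].  Searching the lengths below   *)
(* [#|G|] suffices because a shortest walk has no repeated vertex; the value  *)
(* is [#|G|] when there is no walk at all.                                    *)
Definition dist (G : sgraph) (x y : G) : nat :=
  find (walk_of_length x y) (iota 0 #|G|).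

Definition transmission (G : sgraph) (u : G) : nat := \sum_(x : G) dist u x.

Definition transmission_regular (G : sgraph) : Prop :=
  forall x y : G, transmission x = transmission y.

Definition STI (k : nat) (G : sgraph) : Prop :=
  [/\ 0 < k, connected G &
      forall x y : G, adj x y -> `|transmission x - transmission y|%N = k].

Section Coalescence.
Variables (r : nat) (G : sgraph) (u : G).

(* [None] is the vertex obtained by identifying the [r] copies of [u].        *)
Definition coal_vertex : finType := option ('I_r * {x : G | x != u}).

(* The image in [rG(u)] of the vertex [x] of the [i]-th copy of [G].          *)
Definition coal_inj (i : 'I_r) (x : G) : coal_vertex :=
  omap (pair i) (insub x).

Definition coal_adj : rel coal_vertex := fun v w =>
  [exists i : 'I_r, exists x : G, exists y : G,
    [&& v == coal_inj i x, w == coal_inj i y & adj x y]].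

Lemma coal_inj_inj i : injective (coal_inj i).
Proof.
move=> x y; rewrite /coal_inj.
case: insubP => [a _ ax|]; case: insubP => [b _ bx|] //=.
  by case=> ab; rewrite -ax -bx ab.
by rewrite !negbK => /eqP-> /eqP->.
Qed.

Lemma coal_adj_sym : symmetric coal_adj.
Proof.
suff sub v w : coal_adj v w -> coal_adj w v.
  by move=> v w; apply/idP/idP; apply: sub.
case/existsP=> i /existsP[x /existsP[y /and3P[vx wy xy]]].
apply/existsP; exists i; apply/existsP; exists y; apply/existsP; exists x.
by rewrite wy vx adj_sym.
Qed.

Lemma coal_adj_irrefl : irreflexive coal_adj.
Proof.
move=> v; apply/negbTE/negP => /existsP[i /existsP[x /existsP[y]]].
by case/and3P=> /eqP-> /eqP/coal_inj_inj ->; rewrite adj_irrefl.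
Qed.

Definition coalescence : sgraph := SGraph coal_adj_sym coal_adj_irrefl.

End Coalescence.

(* Main.v *)
Require Import Defs.
From HB Require Import structures.
From mathcomp Require Import all_boot all_algebra.
From mathcomp Require Import zify.

Set Implicit Arguments.
Unset Strict Implicit.
Unset Printing Implicit Defensive.

(** A vertex [x] in one copy of [G] reaches the vertices of every other copy
    through [u], so its transmission in [rG(u)] is
    [Tr(x) + (r - 1) * ((n - 1) * d(x, u) + Tr(u))].  By transmission regularity
    only [d(x, u)] depends on [x], and in a bipartite graph it changes by
    exactly one along every edge. *)

Section Distance.
Variable G : sgraph.
Implicit Types (x y z : G) (p : seq G).

(** Were [size p] below the index returned by [find], the test at that length would have failed, yet
    [p] itself passes it. *)
Lemma dist_path_le x p : path (@adj G) x p -> dist x (last x p) <= size p.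
Proof.
move=> xp; rewrite leqNgt; apply/negP => lt_p.
have p_lt : size p < #|G|.
  by rewrite -(size_iota 0 #|G|) (leq_trans lt_p) // find_size.
have := before_find 0 lt_p; rewrite nth_iota // => /negbT/negP; apply.
by apply/existsP; exists (in_tuple p); rewrite /= xp eqxx.
Qed.

Lemma dist_pathP x y : connect (@adj G) x y ->
  exists p, [/\ path (@adj G) x p, last x p = y & size p = dist x y].
Proof.
case/connectP=> p0 p0P ->; case: (shortenP p0P) => p xp uniq_p _.
(* The vertices of [x :: p] are distinct, so the length of [p] lies in the searched range. *)
have p_lt : size p < #|G|.
  by rewrite cardE (uniq_leq_size uniq_p) // => z; rewrite mem_enum.
have hasW : has (walk_of_length x (last x p)) (iota 0 #|G|).
  apply/hasP; exists (size p); first by rewrite mem_iota.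
  by apply/existsP; exists (in_tuple p); rewrite /= xp eqxx.
have := nth_find 0 hasW; rewrite -/(dist x (last x p)) nth_iota; last first.
  by rewrite -[X in _ < X](size_iota 0) -has_find.
case/existsP=> q /andP[xq /eqP lq]; exists q; split=> //.
by rewrite size_tuple add0n.
Qed.

Lemma distxx x : dist x x = 0.
Proof. by apply/eqP; rewrite -leqn0 (@dist_path_le x [::]). Qed.

Lemma dist_adj_le x y : adj x y -> dist x y <= 1.
Proof. by move=> xy; apply: (@dist_path_le x [:: y]); rewrite /= xy. Qed.

(** Serves to bound distances from below by a potential function. *)
Lemma path_Lipschitz (f : G -> nat) x p :
    (forall y z, adj y z -> f z <= (f y).+1) ->
  path (@adj G) x p -> f (last x p) <= f x + size p.
Proof.
move=> fL; elim: p x => [|y p IHp] x /=; first by rewrite addn0.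
case/andP=> /fL fxy /IHp /leq_trans; apply.
by rewrite addnS -addSn leq_add2r.
Qed.

Lemma path_color (c : G -> bool) x p : (forall y z, adj y z -> c y != c z) ->
  path (@adj G) x p -> c (last x p) = c x (+) odd (size p).
Proof.
move=> cP; elim: p x => [|y p IHp] x /=; first by rewrite addbF.
by case/andP=> /cP + /IHp ->; case: (c x) (c y) (odd _) => [] [] [].
Qed.

Hypothesis connG : connected G.

Lemma dist_triangle x y z : dist x z <= dist x y + dist y z.
Proof.
have [p [xp lp <-]] := dist_pathP (connG x y).
have [q [yq <- <-]] := dist_pathP (connG y z).
by rewrite -lp -last_cat -size_cat dist_path_le // cat_path xp lp.
Qed.

(** The triangle inequality keeps the two distances within one of each other. They cannot be equal:
    the colours of the ends fix the parity of a distance, and [x] and [y] have different colours. *)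
Lemma bipartite_dist_adj x y z : bipartite G -> adj x y ->
  dist x z = (dist y z).+1 \/ dist y z = (dist x z).+1.
Proof.
case=> c cP xy.
have parity v : c z = c v (+) odd (dist v z).
  by have [p [vp <- <-]] := dist_pathP (connG v z); apply: path_color.
have yx : adj y x by rewrite adj_sym.
have := dist_triangle x y z; have := dist_triangle y x z.
have := dist_adj_le xy; have := dist_adj_le yx.
have : dist x z != dist y z.
  apply: contraNneq (cP _ _ xy) => eq_d; apply/eqP.
  by apply: (@addIb (odd (dist x z))); rewrite -parity eq_d -parity.
lia.
Qed.

End Distance.

Section Coalescence.
Variables (r : nat) (G : sgraph) (u : G).
Implicit Types (i j : 'I_r) (x y : G).

Let H := coalescence r u.
Let inj i x : H := coal_inj u i x.

Lemma coal_inj_root i : inj i u = None.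
Proof. by rewrite /inj /coal_inj insubF ?eqxx. Qed.

Lemma coal_injK i (a : {x : G | x != u}) : inj i (val a) = Some (i, a).
Proof. by rewrite /inj /coal_inj valK. Qed.

Lemma coal_injP (v : H) : 0 < r -> exists i, exists x, v = inj i x.
Proof.
move=> r_gt0; case: v => [[i a]|].
  by exists i, (val a); rewrite coal_injK.
by exists (Ordinal r_gt0), u; rewrite coal_inj_root.
Qed.

Lemma coal_adjP (v w : H) :
  reflect (exists i x y, [/\ v = inj i x, w = inj i y & adj x y]) (adj v w).
Proof.
apply: (iffP existsP) => [[i /existsP[x /existsP[y /and3P[]]]]|].
  by move=> /eqP-> /eqP-> xy; exists i, x, y.
case=> i [x [y [-> -> xy]]]; exists i; apply/existsP; exists x.
by apply/existsP; exists y; rewrite !eqxx.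
Qed.

Lemma coal_inj_path i x p :
  path (@adj G) x p -> path (@adj H) (inj i x) (map (inj i) p).
Proof.
elim: p x => //= y p IHp x /andP[xy /IHp ->]; rewrite andbT.
by apply/coal_adjP; exists i, x, y.
Qed.

Lemma sum_coalescence (F : H -> nat) :
  \sum_v F v = F None + \sum_i \sum_(x | x != u) F (inj i x).
Proof.
rewrite (bigD1 (None : H)) //=; congr (_ + _).
rewrite (reindex_omap (Some : _ -> H) id) /=; last by case.
rewrite (eq_bigl predT); last by move=> ?; rewrite eqxx.
transitivity (\sum_i \sum_a F (Some (i, a))).
  by rewrite pair_bigA; apply: eq_bigr => -[].
apply: eq_bigr => i _.
rewrite [RHS](reindex_omap val (insub : G -> option {x | x != u})) /=; last first.
  by move=> x xu; rewrite insubT.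
by apply: eq_big => [a|a _]; rewrite ?coal_injK // valK eqxx (valP a).
Qed.

Hypothesis connG : connected G.

Lemma connected_coalescence : 0 < r -> connected H.
Proof.
move=> r_gt0.
have conn i x y : connect (@adj H) (inj i x) (inj i y).
  have /connectP[p xp ->] := connG x y.
  rewrite -last_map; apply/connectP.
  by exists (map (inj i) p); rewrite ?coal_inj_path.
move=> v w.
have [i [x ->]] := coal_injP v r_gt0; have [j [y ->]] := coal_injP w r_gt0.
apply: connect_trans (conn i x u) _.
(* The copies of [u] coincide, so the walk may switch from copy [i] to copy [j] here. *)
by rewrite coal_inj_root -(coal_inj_root j).
Qed.

Lemma dist_coalescence i j x y :
  dist (inj i x) (inj j y) = if j == i then dist x y else dist x u + dist u y.
Proof.
have r_gt0 : 0 < r by apply: leq_ltn_trans (ltn_ord i).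
have connH := connected_coalescence r_gt0.
have dist_inj k z t : dist (inj k z) (inj k t) <= dist z t.
  have [p [zp <- <-]] := dist_pathP (connG z t).
  by rewrite -last_map -(size_map (inj k)) dist_path_le ?coal_inj_path.
apply/eqP; rewrite eqn_leq; apply/andP; split.
  (* Upper bound: shortest paths of [G] map into each copy, and two different copies are joined
     through [u]. *)
  case: eqP => [->|_]; first exact: dist_inj.
  apply: leq_trans (dist_triangle connH _ (inj i u) _) _.
  by rewrite leq_add ?dist_inj // coal_inj_root -(coal_inj_root j).
(* The right-hand side, as a function of the target, grows by at most one along
   each edge, hence is at most the length of any walk from [inj i x]. *)
pose D (v : H) := if v is Some (k, a)
  then if k == i then dist x (val a) else dist x u + dist u (val a)
  else dist x u.
have DE k z : D (inj k z) = if k == i then dist x z else dist x u + dist u z.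
  (* At [u] both branches equal [dist x u], so the value of [D] at [None] fits every copy. *)
  have [->|zu] := eqVneq z u; first by rewrite coal_inj_root distxx addn0 if_same.
  by rewrite -[z]/(val (Sub z zu : {x | x != u})) coal_injK.
have D_Lipschitz v w : adj v w -> D w <= (D v).+1.
  case/coal_adjP=> k [z [t [-> -> zt]]]; rewrite !DE.
  have step a : dist a t <= (dist a z).+1.
    apply: leq_trans (dist_triangle connG _ z _) _.
    by rewrite -addn1 leq_add2l dist_adj_le.
  by case: ifP => _; rewrite ?step // -addnS leq_add2l.
have [p [vp lp <-]] := dist_pathP (connH (inj i x) (inj j y)).
by have := path_Lipschitz D_Lipschitz vp; rewrite lp !DE eqxx distxx.
Qed.

Lemma transmission_coalescence i x :
  transmission (inj i x) =
    transmission x + (r - 1) * ((#|G| - 1) * dist x u + transmission u).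
Proof.
have trE z : transmission z = dist z u + \sum_(y | y != u) dist z y.
  by rewrite /transmission (bigD1 u).
rewrite {1}/transmission sum_coalescence -(coal_inj_root i) dist_coalescence eqxx.
(* The identified vertex and the rest of copy [i] together give [transmission x]. *)
rewrite (bigD1 i) //= addnA trE; congr (_ + _ + _).
  by apply: eq_bigr => y _; rewrite dist_coalescence eqxx.
(* Each of the other [r - 1] copies contributes the same amount: all its [#|G| - 1] vertices apart
   from [u] cost the detour [dist x u]. *)
rewrite (eq_bigr (fun=> (#|G| - 1) * dist x u + transmission u)) => [|j ji].
  by rewrite sum_nat_const cardC1 card_ord !subn1.
under eq_bigr => y _ do rewrite dist_coalescence (negbTE ji).
by rewrite big_split /= sum_nat_const cardC1 subn1 trE distxx.
Qed.

End Coalescence.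

Theorem proposition4p1 (G : sgraph) (n : nat) (u : G) (r : nat) :
  connected G -> bipartite G -> transmission_regular G ->
  #|G| = n -> 2 <= n -> 2 <= r ->
  STI ((r - 1) * (n - 1)) (coalescence r u).
Proof.
move=> connG bipG regG cardG n_ge2 r_ge2; split.
- by rewrite muln_gt0 !subn_gt0 r_ge2 n_ge2.
- exact/connected_coalescence/ltnW.
move=> v w /coal_adjP[i [x [y [-> -> xy]]]].
(* With equal transmissions in [G], the difference is [(r - 1) * (n - 1)] times that of the
   distances to [u], which is one. *)
rewrite !transmission_coalescence // cardG (regG y x).
by case: (bipartite_dist_adj connG u bipG xy) => ->; nia.
Qed.
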